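(* If there exist a solution $q\in\mathcal S$ and $u(x,t;q)$ of the inverse problem $$u_t-(a(x)u_x)_x+q(x)u=0\ \text{ in } Q,\qquad u(x,0)=\phi(x),\ x\in(0,l),\qquad u(x,T)=g(x),\ x\in[0,l],$$ then the solution is unique in the set $\mathcal S_q$.
   Context: Let $l,T>0$, $Q=(0,l)\times(0,T]$, $\delta>0$ an arbitrarily small constant and $G_\delta=(-\delta,l+\delta)$. For an open set $\Omega$, $W^{k,\infty}(\Omega)=\{u: D^\alpha u\in L^\infty(\Omega)\ \forall |\alpha|\le k\}$. Assumptions on the given data: $a\in C^1[0,l]$, $a(0)=a(l)=0$, $a(x)>0$ for $x\in(0,l)$; $a\in W^{4,\infty}(G_\delta)$ with $a\ge 0$ on $G_\delta$; $\phi\in W^{5,\infty}(G_\delta)$, $\phi(x)\ge 0$ and $\phi\not\equiv 0$ on $(0,l)$; $g\in L^\infty(0,l)$. No boundary condition is imposed at $x=0$ and $x=l$. In the inverse problem the unknowns are the coefficient $q$ and the function $u$. $\mathcal S=\{q: q\in W^{3,\infty}(G_\delta),\ q\ge 0\}$. For $q_1,q_2\in\mathcal S$, $q_1\ge q_2$ means $q_1(x)\ge q_2(x)$ for all $x\in G_\delta$, and $q_1\le q_2$ is defined analogously. For $q\in\mathcal S$, $$\mathcal S_q=\{q_1\in\mathcal S:\ q_1\ge q\ \text{ or }\ q_1\le q\}.$$ For $q\in\mathcal S$, $u(x,t;q)$ denotes the unique solution in $W^{3,\infty}(\bar Q)$ of the initial value problem $u_t-(a(x)u_x)_x+q(x)u=0$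 in $Q$, $u(x,0)=\phi(x)$.
   Formalization: Uniqueness of the coefficient q is stated on [0,l] only, not on all of G_δ: values of q outside [0,l] do not enter the problem, so uniqueness as functions on G_δ fails; uniqueness of u is stated on all of the closed rectangle. *)

(* Defs.v *)
From HB Require Import structures.
From mathcomp Require Import all_boot all_order all_algebra.
From mathcomp Require Import all_classical all_reals all_analysis.

Set Implicit Arguments.
Unset Strict Implicit.
Unset Printing Implicit Defensive.

Import Order.TTheory GRing.Theory Num.Theory.
Import numFieldNormedType.Exports.

Local Open Scope classical_set_scope.
Local Open Scope ring_scope.

(* Membership in L^oo(D), for measurable D, is that of the extension by zero. *)
Definition Linf d (X : measurableType d) (R : realType)
    (mu : {measure set X -> \bar R}) (D : set X) (f : X -> R) : Prop :=
  (f \_ D) \in Lfun mu +oo%E.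

Section sobolev1.
Context {R : realType}.

Definition test_function1 (Om : set R) (psi : R -> R) : Prop :=
  (forall n x, derivable (derive1n n psi) x 1) /\
  exists K : set R, [/\ compact K, K `<=` Om & forall x, ~ K x -> psi x = 0].

Definition weak_derivative1 (Om : set R) (n : nat) (f v : R -> R) : Prop :=
  forall psi, test_function1 Om psi ->
    \int[lebesgue_measure]_(x in Om) (f x * derive1n n psi x) =
    (-1) ^+ n * \int[lebesgue_measure]_(x in Om) (v x * psi x).

(* W^{k,oo}(Om) for Om open and k >= 1. A class of functions equal almost
   everywhere is represented by its continuous member, so that pointwise
   values make sense. *)
Definition Winf1 (k : nat) (Om : set R) (f : R -> R) : Prop :=
  (forall x, Om x -> {for x, continuous f}) /\
  forall n, (n <= k)%N ->
    exists2 v : R -> R, Linf lebesgue_measure Om v & weak_derivative1 Om n f v.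

End sobolev1.

Section sobolev2.
Context {R : realType}.
Implicit Types (f v psi : R -> R -> R) (D Om : set (R * R)).

Definition partial_x f : R -> R -> R := fun x t => derive1 (f ^~ t) x.
Definition partial_t f : R -> R -> R := fun x t => derive1 (f x) t.

Fixpoint Ck (k : nat) f : Prop :=
  continuous (fun z : R * R => f z.1 z.2) /\
  if k is k'.+1 then
    [/\ forall x t, derivable (f ^~ t) x 1, forall x t, derivable (f x) t 1,
        Ck k' (partial_x f) & Ck k' (partial_t f)]
  else True.

Definition test_function2 Om psi : Prop :=
  (forall k, Ck k psi) /\
  exists K : set (R * R),
    [/\ compact K, K `<=` Om & forall x t, ~ K (x, t) -> psi x t = 0].

Definition lebesgue_measure2 := (@lebesgue_measure R \x @lebesgue_measure R)%E.

Definition weak_derivative2 Om (i j : nat) f v : Prop :=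
  forall psi, test_function2 Om psi ->
    \int[lebesgue_measure2]_(z in Om)
      (f z.1 z.2 * iter i partial_x (iter j partial_t psi) z.1 z.2) =
    (-1) ^+ (i + j) *
    \int[lebesgue_measure2]_(z in Om) (v z.1 z.2 * psi z.1 z.2).

(* W^{k,oo}(D), k >= 1, for D the closure of a bounded open rectangle: the weak
   derivatives are taken in the interior of D, and the representative is the
   one that is continuous on D. *)
Definition Winf2 (k : nat) D f : Prop :=
  {within D, continuous (fun z : R * R => f z.1 z.2)} /\
  forall i j, (i + j <= k)%N ->
    exists2 v, Linf lebesgue_measure2 (interior D) (fun z => v z.1 z.2)
             & weak_derivative2 (interior D) i j f v.

End sobolev2.

Section problem.
Context {R : realType}.
Implicit Types (l T delta : R) (a phi g q : R -> R) (u : R -> R -> R).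

(* C^1[0, l]: the derivative in the interior extends continuously to [0, l],
   which is the same as using one-sided derivatives at the endpoints. *)
Definition C1_closed l a : Prop :=
  derivable_oo_LRcontinuous a 0 l /\
  exists2 a' : R -> R, {within `[0, l], continuous a'}
                     & {in `]0, l[, forall x, derive1 a x = a' x}.

Definition Gset l delta : set R := [set` `]- delta, l + delta[].
Definition Qbar l T : set (R * R) := [set` `[0, l]] `*` [set` `[0, T]].

Definition data_assumptions l delta a phi g : Prop :=
  [/\ [/\ C1_closed l a, a 0 = 0, a l = 0 & {in `]0, l[, forall x, 0 < a x}],
      Winf1 4 (Gset l delta) a /\ (forall x, Gset l delta x -> 0 <= a x),
      [/\ Winf1 5 (Gset l delta) phi, {in `]0, l[, forall x, 0 <= phi x}
        & exists2 x, x \in `]0, l[ & phi x != 0]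
    & Linf lebesgue_measure [set` `]0, l[] g].

(* u_t(x, t) = d relative to the time interval (0, T]: a two-sided derivative
   for t < T, a left derivative for t = T. *)
Definition has_time_derivative T u (x t d : R) : Prop :=
  h^-1 * (u x (t + h) - u x t) @[h --> within [set h | t + h <= T] 0^'] --> d.

Definition solves_equation l T a q u : Prop :=
  forall x t : R, x \in `]0, l[ -> t \in `]0, T] ->
    let flux y := a y * partial_x u y t in
    [/\ derivable (u ^~ t) x 1, derivable flux x 1
      & exists2 d, has_time_derivative T u x t d
                 & d - derive1 flux x + q x * u x t = 0].

Definition solves_ivp l T a phi q u : Prop :=
  [/\ Winf2 3 (Qbar l T) u, solves_equation l T a q u
    & {in `]0, l[, forall x, u x 0 = phi x}].

Definition calS l delta : set (R -> R) :=
  [set q | Winf1 3 (Gset l delta) q /\ forall x, Gset l delta x -> 0 <= q x].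

Definition calS_at l delta q : set (R -> R) :=
  [set q1 | calS l delta q1 /\
    ((forall x, Gset l delta x -> q x <= q1 x) \/
     (forall x, Gset l delta x -> q1 x <= q x))].

Definition solves_inverse l T delta a phi g q u : Prop :=
  [/\ calS l delta q, solves_ivp l T a phi q u
    & {in `[0, l], forall x, u x T = g x}].

End problem.

(* Main.v *)
(* No boundary condition is needed because the diffusion is so weak at the ends
   that [0, l] behaves like the whole line: if [a h' = 2 x - l], then [h] blows
   up at both ends while [(a h')'] is bounded, and adding a small multiple of
   [h] to a bounded supersolution forces its minimum to be interior. This gives
   a minimum principle for merely continuous supersolutions. Comparison with a
   compactly supported bump that travels along a straight line in space-time
   shows moreover that [u(., T) > 0] in the interior.

   If [q <= q1], then [w = u - u1] satisfies
   [w_t - (a w_x)_x + q w = (q1 - q) u1 >= 0], hence [w >= 0]; as [w(., T) = 0],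
   at the final time the left-hand side reduces to [w_t <= 0], so
   [(q1 - q) u1(., T) <= 0] and [q1 = q]. The minimum principle applied to
   [w] and [- w] then gives [u1 = u]. *)
Require Import Defs.
From mathcomp Require Import all_boot all_order all_algebra.
From mathcomp Require Import all_classical all_reals all_analysis.
From mathcomp Require Import ring lra.
Import Order.TTheory GRing.Theory Num.Theory.
Import numFieldNormedType.Exports.
Local Open Scope classical_set_scope.
Local Open Scope ring_scope.

Set Implicit Arguments.
Unset Strict Implicit.

(** * Values of the parabolic operator and their linearity *)

(** A relation rather than a function, so that it also carries the existence of the derivatives.
    Derivability in space is required near [x], not only at [x]: the flux of a sum must be the sum
    of the fluxes on a neighbourhood before it can be differentiated. *)
Definition residual_at {R : realType} (T : R) (a q : R -> R) (w : R -> R -> R)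
    (x t r : R) : Prop :=
  [/\ \forall y \near x, derivable (w ^~ t) y 1,
      derivable (fun y => a y * partial_x w y t) x 1
    & exists2 d, has_time_derivative T w x t d
               & d - derive1 (fun y => a y * partial_x w y t) x + q x * w x t
                 = r].

Lemma is_derive_time {R : realType} (T : R) (w : R -> R -> R) (x t d : R) :
  is_derive t 1 (w x) d -> has_time_derivative T w x t d.
Proof.
move=> [/cvg_ex[/= d' wd]].
rewrite /derive (cvg_lim _ wd)// => <-; apply: cvg_within_filter.
apply: cvg_trans wd; apply: near_eq_cvg; near=> h.
by rewrite /= /GRing.scale/= mulr1 (addrC t).
Unshelve. all: by end_near. Qed.

Lemma residual_at_is_derive {R : realType} (T : R) (a q : R -> R)
    (w : R -> R -> R) (wx : R -> R) (x t F d : R) :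
  (\forall y \near x, is_derive (y : R) 1 (w ^~ t) (wx y)) ->
  is_derive x 1 (fun y => a y * wx y) F ->
  is_derive t 1 (w x) d ->
  residual_at T a q w x t (d - F + q x * w x t).
Proof.
move=> wxE dF dw.
have nF : \forall y \near x, a y * wx y = a y * partial_x w y t.
  near=> y; rewrite /partial_x derive1E; congr (_ * _).
  by apply/esym/derive_val; near: y.
have [dF1 dF2] := near_eq_is_derive nF dF.
split; [|exact: dF1|].
  by apply: filterS wxE => y [].
exists d; first exact: is_derive_time.
by rewrite derive1E dF2.
Unshelve. all: by end_near. Qed.

Lemma is_derive_lincomb {R : realType} (f g : R -> R) (c x : R) :
  derivable f x 1 -> derivable g x 1 ->
  is_derive x 1 (fun y => f y + c * g y) (derive1 f x + c * derive1 g x).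
Proof.
move=> df dg; rewrite !derive1E.
exact: (is_deriveD (derivableP df) (is_deriveZ c (derivableP dg))).
Qed.

Lemma residual_at_lincomb {R : realType} (T : R) (a q : R -> R)
    (w1 w2 : R -> R -> R) (c x t r1 r2 : R) :
  residual_at T a q w1 x t r1 -> residual_at T a q w2 x t r2 ->
  residual_at T a q (fun y s => w1 y s + c * w2 y s) x t (r1 + c * r2).
Proof.
move=> [n1 f1 [d1 td1 <-]] [n2 f2 [d2 td2 <-]].
have nF : \forall y \near x,
    a y * partial_x w1 y t + c * (a y * partial_x w2 y t)
    = a y * partial_x (fun y s => w1 y s + c * w2 y s) y t.
  apply: filterS2 n1 n2 => y dw1 dw2; rewrite {3}/partial_x.
  have [_] := is_derive_lincomb c dw1 dw2.
  by rewrite -derive1E => ->; rewrite mulrDr mulrCA.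
have [dF1 dF2] := near_eq_is_derive nF (is_derive_lincomb c f1 f2).
split; [|exact: dF1|].
  apply: filterS2 n1 n2 => y dw1 dw2.
  by have [] := is_derive_lincomb c dw1 dw2.
exists (d1 + c * d2); last first.
  rewrite derive1E dF2.
  move: (derive1 (fun y => a y * partial_x w1 y t) x) => F1.
  move: (derive1 (fun y => a y * partial_x w2 y t) x) => F2.
  by ring.
rewrite /has_time_derivative.
have -> : (fun h => h^-1 * ((w1 x (t + h) + c * w2 x (t + h)) -
                            (w1 x t + c * w2 x t))) =
  (fun h => h^-1 * (w1 x (t + h) - w1 x t) +
            c * (h^-1 * (w2 x (t + h) - w2 x t))).
  by apply/funext => h; ring.
apply: cvgD; [exact: td1|apply: cvgMr; exact: td2].
Qed.

(** * Minima and the minimum principle on compact sets *)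

Lemma has_time_derivative_left {R : realType} (T : R) (w : R -> R -> R)
    (x t d : R) : t <= T -> has_time_derivative T w x t d ->
  h^-1 * (w x (t + h) - w x t) @[h --> 0^'-] --> d.
Proof.
move=> tT; apply: cvg_trans; apply: cvg_app => A.
rewrite /within/= => -[e e0 /= eA]; exists e => //= h he h0.
by apply: eA => //=; [exact: ltr0_neq0|rewrite (le_trans _ tT)// gerDl ltW].
Qed.

(** Only earlier times are compared, so that this also applies at [t = T]. *)
Lemma time_derivative_past_min {R : realType} (T : R) (w : R -> R -> R)
    (x t d : R) : t <= T -> has_time_derivative T w x t d ->
  (\forall h \near 0^'-, w x t <= w x (t + h)) -> d <= 0.
Proof.
move=> tT /(has_time_derivative_left tT) wd wmin.
apply: (cvgr_to_le wd); near=> h.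
apply: mulr_le0_ge0; last by rewrite subr_ge0; near: h.
by rewrite invr_le0; near: h; exact: nbhs_left_le.
Unshelve. all: by end_near. Qed.

Lemma near_itvoo {R : realType} (x : R) (P : R -> Prop) :
  (\forall y \near x, P y) ->
  exists2 e, 0 < e & forall y, y \in `]x - e, x + e[ -> P y.
Proof.
move=> [e /= e0 eP]; exists e => // y; rewrite in_itv/= => xy.
by apply: eP; rewrite /= distrC ltr_distl.
Qed.

(** Only the flux can be differentiated, so there is no second derivative of [w] to test. The flux
    vanishes at [x] because [w] has a critical point there. If its derivative were negative, the
    flux would be negative just to the right of [x], hence so would [derive1 w] since [a >= 0], and
    by the mean value theorem [w] would drop below its minimum. *)
Lemma flux_derive_at_min {R : realType} (a w : R -> R) (x : R) :
  (\forall y \near x, 0 <= a y) ->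
  (\forall y \near x, derivable w y 1) ->
  derivable (fun y => a y * derive1 w y) x 1 ->
  (\forall y \near x, w x <= w y) ->
  0 <= derive1 (fun y => a y * derive1 w y) x.
Proof.
move=> a0 dw dF wmin; rewrite leNgt; apply/negP => F0.
have [e e_gt0 ewmin] := near_itvoo (filterI dw wmin).
have xe : x \in `]x - e, x + e[ by rewrite in_itv/= ltrBlDr !ltrDl e_gt0.
have wx0 : derive1 w x = 0.
  rewrite derive1E; apply: derive_val; apply: (derive1_at_min _ _ xe).
  - by rewrite lerD2l ge0_cp// ltW.
  - by move=> y /ewmin[].
  - by move=> y /ewmin[].
rewrite derive1E in F0.
have Fx0 : a x * derive1 w x = 0 by rewrite wx0 mulr0.
have Fr : \forall h \near 0^', h^-1 * (a (h + x) * derive1 w (h + x)) < 0.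
  have : h^-1 *: (a (h *: 1 + x) * derive1 w (h *: 1 + x) - a x * derive1 w x)
    @[h --> 0^'] --> 'D_1 (fun y => a y * derive1 w y) x by exact: dF.
  move/cvgr_lt => /(_ _ F0); apply: filterS => h.
  by rewrite Fx0 subr0 /GRing.scale/= mulr1.
move: Fr => [e1 /= e1_gt0 Fr].
have [e2 e2_gt0 a02] := near_itvoo a0.
pose y := x + Num.min e (Num.min e1 e2) / 2.
have m_gt0 : 0 < Num.min e (Num.min e1 e2) by rewrite !lt_min e_gt0 e1_gt0.
have xy : x < y by rewrite ltrDl divr_gt0.
have mlt : Num.min e (Num.min e1 e2) / 2 < Num.min e (Num.min e1 e2).
  by rewrite ltr_pdivrMr// ltr_pMr// ltr1n.
have [mle mle1 mle2] : [/\ Num.min e (Num.min e1 e2) <= e,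
    Num.min e (Num.min e1 e2) <= e1 & Num.min e (Num.min e1 e2) <= e2].
  by rewrite !ge_min !lexx !orbT.
have inye z : x <= z <= y -> z \in `]x - e, x + e[.
  move=> /andP[xz zy]; rewrite in_itv/=; apply/andP; split.
    by rewrite ltrBlDr (le_lt_trans xz)// ltrDl.
  by rewrite (le_lt_trans zy)// /y ltrD2l (lt_le_trans mlt).
have [||z zxy wyz] := @MVT _ w (derive1 w) x y xy.
- move=> z; rewrite in_itv/= => /andP[xz zy].
  have [|dwz _] := ewmin z; first by apply: inye; rewrite !ltW.
  by rewrite derive1E; exact/derivableP.
- apply: derivable_within_continuous => z; rewrite in_itv/= => zxy.
  by have [] := ewmin z (inye _ zxy).
move: zxy; rewrite in_itv/= => /andP[xz zy].
have zm : z - x < Num.min e (Num.min e1 e2).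
  by rewrite ltrBlDl (lt_trans zy)// ltrD2l.
have zx0 : 0 < z - x by rewrite subr_gt0.
have := Fr (z - x); rewrite /= sub0r normrN gtr0_norm// (lt_le_trans zm)//.
move=> /(_ isT) /(_ (lt0r_neq0 zx0)).
rewrite subrK pmulr_rlt0 ?invr_gt0// => Fz.
have az : 0 <= a z.
  apply: a02; rewrite in_itv/= ltrBlDr (lt_trans xz) ?ltrDl//=.
  by rewrite -ltrBlDl (lt_le_trans zm).
have wz : derive1 w z < 0.
  by rewrite ltNge; apply/negP => wz; move: Fz; rewrite ltNge mulr_ge0.
have [|_] := ewmin y; first by apply: inye; rewrite (ltW xy) lexx.
by rewrite -subr_ge0 wyz leNgt nmulr_rlt0// subr_gt0 xy.
Qed.

Lemma residual_at_min {R : realType} (T : R) (a q : R -> R)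
    (w : R -> R -> R) (x t r : R) :
  t <= T -> 0 <= q x -> w x t <= 0 ->
  (\forall y \near x, 0 <= a y) ->
  (\forall y \near x, w x t <= w y t) ->
  (\forall h \near 0^'-, w x t <= w x (t + h)) ->
  residual_at T a q w x t r -> r <= 0.
Proof.
move=> tT q0 w0 a0 wminx wmint [dw dF [d td <-]].
have d0 := time_derivative_past_min tT td wmint.
have F0 := flux_derive_at_min a0 dw dF wminx.
rewrite -oppr_ge0 opprD opprB addr_ge0//.
  by rewrite subr_ge0 (le_trans d0).
by rewrite oppr_ge0 mulr_ge0_le0.
Qed.

(** At a negative minimum all three terms of the operator are nonpositive, which contradicts
    [0 < r]. The set [D] is arbitrary, to serve both for rectangles and for slanted tubes; its
    parabolic boundary enters only through the demand that every point where [w] is negative lie off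
    it. *)
Lemma min_principle {R : realType} (T : R) (a q : R -> R) (w : R -> R -> R)
    (D : set (R * R)) :
  compact D -> {within D, continuous (fun z => w z.1 z.2)} ->
  (forall x t, D (x, t) -> w x t < 0 ->
     [/\ t <= T, 0 <= q x,
         \forall y \near x, D (y, t) /\ 0 <= a y,
         \forall h \near 0^'-, D (x, t + h)
       & exists2 r, 0 < r & residual_at T a q w x t r]) ->
  forall x t, D (x, t) -> 0 <= w x t.
Proof.
move=> cD wD intD x0 t0 Dxt0.
have [//|[x t] /set_mem Dxt wmin] := compact_EVT_min _ cD wD.
  by exists (x0, t0).
apply: le_trans (wmin (x0, t0) _); last exact/mem_set.
rewrite leNgt; apply/negP => /= wlt0.
have [tT qx nx nh [r r0 res]] := intD _ _ Dxt wlt0.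
move: r0; apply/negP; rewrite -leNgt.
apply: (residual_at_min tT qx (ltW wlt0) _ _ _ res).
- by apply: filterS nx => y [].
- by apply: filterS nx => y [Dy _]; exact: (wmin (y, t) (mem_set Dy)).
- by apply: filterS nh => h Dh; exact: (wmin (x, t + h) (mem_set Dh)).
Qed.

(** * The barrier that is singular at both ends *)

Lemma primitive_oo {R : realType} (f : R -> R) (a b : R) : a < b ->
  {in `]a, b[, continuous f} ->
  exists h : R -> R, {in `]a, b[, forall x : R, is_derive x 1 h (f x)}.
Proof.
move=> ab cf; pose m := (a + b) / 2.
have am : a < m by rewrite midf_lt.
have mb : m < b by rewrite midf_lt.
(* The base point is the midpoint because [f] may fail to be integrable up to the ends. One of the
   two intervals is always empty, so the difference is the oriented integral from [m] to [x]. *)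
exists (fun x => \int[lebesgue_measure]_(y in `]m, x]) f y -
                 \int[lebesgue_measure]_(y in `]x, m]) f y) => x.
rewrite in_itv/= => /andP[ax xb].
pose c := (a + Num.min x m) / 2.
have axm : a < Num.min x m by rewrite lt_min ax.
have ac : a < c by rewrite midf_lt.
have : c < Num.min x m by rewrite midf_lt.
rewrite lt_min => /andP[cx cm].
pose d := (Num.max x m + b) / 2.
have xmb : Num.max x m < b by rewrite gt_max xb.
have db : d < b by rewrite midf_lt.
have : Num.max x m < d by rewrite midf_lt.
rewrite gt_max => /andP[xd md].
have intf u : c <= u -> u <= d ->
    lebesgue_measure.-integrable `[c, u] (EFin \o f).
  move=> cu ud; apply: continuous_compact_integrable.
    exact: segment_compact.
  apply: continuous_in_subspaceT => y; rewrite inE/= in_itv/= => /andP[cy yu].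
  apply: cf; rewrite in_itv/= (lt_le_trans ac)//=.
  by rewrite (le_lt_trans yu)// (le_lt_trans ud).
have xE : x \in `]a, b[ by rewrite in_itv/= ax xb.
have intcd := intf d (ltW (lt_trans cx xd)) (lexx d).
have [dF F'] := continuous_FTC1_closed xd intcd cx (cf x xE).
(* On [[c, d]], which contains both [x] and [m], the primitive is the integral from [c] minus a
   constant. *)
have dF1 : is_derive x 1 (fun y => \int[lebesgue_measure]_(z in `[c, y]) f z -
                         \int[lebesgue_measure]_(z in `[c, m]) f z) (f x).
  apply: is_derive_eq.
    apply: is_deriveB.
    by apply: DeriveDef; [exact: dF|reflexivity].
  by rewrite subr0 -derive1E F'.
apply: near_eq_is_derive dF1.
near=> y.
have cy : c <= y by apply: ltW; near: y; exact: lt_nbhsr.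
have yd : y <= d by apply: ltW; near: y; exact: lt_nbhsl.
have [my|ym] := leP m y.
  rewrite (Rintegral_itvB (a := BLeft c) (b := BRight y) (x := m));
    rewrite ?bnd_simp ?(ltW cm)//; last exact: intf.
  rewrite [X in _ = _ - X](_ : _ = 0) ?subr0//.
  by rewrite set_itv_ge ?bnd_simp -?leNgt// Rintegral_set0.
rewrite -opprB (Rintegral_itvB (a := BLeft c) (b := BRight m) (x := y));
  rewrite ?bnd_simp ?(ltW ym)//; last exact: intf (ltW cm) (ltW md).
rewrite [X in _ = X - _](_ : _ = 0) ?sub0r//.
by rewrite set_itv_ge ?bnd_simp -?leNgt ?(ltW ym)// Rintegral_set0.
Unshelve. all: by end_near. Qed.

(** The continuous extension of the derivative is bounded on the segment; the mean value theorem,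
    started from either end where [a] vanishes, turns this bound into linear ones. Adding 1 to the
    maximum makes the constant positive. *)
Lemma C1_closed_bounds {R : realType} (l : R) (a : R -> R) : 0 < l ->
  C1_closed l a -> a 0 = 0 -> a l = 0 ->
  exists2 C, 0 < C &
    {in `]0, l[, forall x, [/\ a x <= C * x, a x <= C * (l - x)
                             & `|derive1 a x| <= C]}.
Proof.
move=> l0 [dla [a' ca' a'E]] a0 al.
have ca := derivable_oo_LRcontinuous_within dla; have [da _ _] := dla.
have [|M _ Mmax] := @EVT_max _ (fun x => `|a' x|) 0 l (ltW l0).
  by move=> x; apply: cvg_norm; exact: ca'.
have bnd x : x \in `]0, l[ -> `|derive1 a x| <= `|a' M| + 1.
  move=> xl; rewrite a'E// (le_trans (Mmax x _)) ?lerDl//.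
  exact: subset_itv_oo_cc xl.
have dax x : x \in `]0, l[ -> is_derive x 1 a (derive1 a x).
  by move=> xl; rewrite derive1E; apply/derivableP/da.
have mvt y z : 0 <= y -> y < z -> z <= l ->
    exists2 c, c \in `]0, l[ & a z - a y = derive1 a c * (z - y).
  move=> y0 yz zl.
  have sub : `]y, z[ `<=` `]0, l[ by apply: subset_itv; rewrite bnd_simp.
  have subc : `[y, z] `<=` `[0, l] by apply: subset_itv; rewrite bnd_simp.
  have dayz c : c \in `]y, z[ -> is_derive c 1 a (derive1 a c).
    by move=> cyz; apply: dax; exact: sub.
  have [c cyz ->] := MVT yz dayz (continuous_subspaceW subc ca).
  by exists c => //; exact: sub.
exists (`|a' M| + 1); first by rewrite ltr_wpDl.
move=> x; rewrite in_itv/= => /andP[x0 xl]; split.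
- have [c cl] := mvt 0 x (lexx 0) x0 (ltW xl).
  rewrite a0 !subr0 => ->; rewrite ler_pM2r//.
  by rewrite (le_trans (ler_norm _))// bnd.
- have [c cl] := mvt x l (ltW x0) xl (lexx l).
  rewrite al sub0r => /(congr1 -%R); rewrite opprK => ->.
  rewrite -mulNr ler_pM2r ?subr_gt0//.
  by rewrite (le_trans (ler_norm _))// normrN bnd.
- by apply: bnd; rewrite in_itv/= x0.
Qed.

(** On the left half [2 * y - l <= 0], so [a y <= C * y] bounds the derivative of [h] above by that
    of [- (l / C) * ln y + (2 / C) * y]. Thus the difference [k] is nonincreasing, and
    [k (l / 2) <= k x] is the claim up to the term [2 / C * x >= 0]. *)
Lemma log_lower_bound {R : realType} (l C : R) (a h : R -> R) :
  0 < l -> 0 < C -> {in `]0, l[, forall x, 0 < a x <= C * x} ->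
  {in `]0, l[, forall x : R, is_derive x 1 h ((2 * x - l) / a x)} ->
  forall x, 0 < x <= l / 2 ->
    h (l / 2) + l / C * (ln (l / 2) - ln x) - l / C <= h x.
Proof.
move=> l0 C0 aC dh x /andP[x0]; rewrite le_eqVlt => /predU1P[->|xl].
  by rewrite subrr mulr0 addr0 gerBl divr_ge0// ltW.
pose k' y := (2 * y - l) / a y + (l / C) * y^-1 - 2 / C.
pose k y := h y + l / C * ln y - 2 / C * y.
have inl y : x <= y <= l / 2 -> y \in `]0, l[.
  by move=> /andP[xy yl]; rewrite in_itv/=; lra.
have dk y : y \in `]0, l[ -> is_derive y 1 k (k' y).
  move=> yl; have dhy := dh y yl; move: yl; rewrite in_itv/= => /andP[y0 _].
  have dln := is_derive1_ln y0.
  have did : is_derive y 1 (fun z : R => 2 / C * z) (2 / C).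
    by apply: is_derive_eq; rewrite /GRing.scale/= mulr1.
  exact: (is_deriveB (is_deriveD dhy (is_deriveZ (l / C) dln)) did).
have dkx y : y \in `]x, l / 2[ -> is_derive y 1 k (k' y).
  by rewrite in_itv/= => /andP[xy yl]; apply: dk; apply: inl; rewrite !ltW.
have ck : {within `[x, l / 2], continuous k}.
  apply: derivable_within_continuous => y; rewrite in_itv/= => xyl.
  by have [] := dk y (inl y xyl).
have [y yE ky] := MVT xl dkx ck.
move: yE; rewrite in_itv/= => /andP[xy yl].
have yE : y \in `]0, l[ by apply: inl; rewrite !ltW.
have y0 : 0 < y by apply: lt_trans xy.
have k'le0 : k' y <= 0.
  have /andP[ay0 ayC] := aC y yE.
  have : (l - 2 * y) / (C * y) <= (l - 2 * y) / a y.
    apply: ler_wpM2l; first by lra.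
    by rewrite lef_pV2// posrE mulr_gt0.
  have -> : (l - 2 * y) / (C * y) = l / C * y^-1 - 2 / C.
    by field; rewrite !gt_eqF.
  rewrite /k' -(opprB l) mulNr; lra.
have : k (l / 2) <= k x by rewrite -subr_le0 ky mulr_le0_ge0// subr_ge0 ltW.
rewrite /k.
have -> : 2 / C * (l / 2) = l / C by field; rewrite gt_eqF.
have : 0 <= 2 / C * x by rewrite mulr_ge0 ?divr_ge0// ltW.
lra.
Qed.

(* [h] blows up because [a], being C^1, vanishes at least linearly at both
   ends. *)
Lemma singular_barrier {R : realType} (l : R) (a : R -> R) : 0 < l ->
  C1_closed l a -> a 0 = 0 -> a l = 0 -> {in `]0, l[, forall x, 0 < a x} ->
  exists h : R -> R,
    [/\ {in `]0, l[, forall x : R, is_derive x 1 h ((2 * x - l) / a x)},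
        exists B, {in `]0, l[, forall x, B <= h x}
      & forall M, exists2 e, 0 < e < l / 2 &
          forall x, x \in `]0, l[ -> M <= h x \/ e < x < l - e].
Proof.
move=> l0 Ca a0 al a_gt0.
have [C C0 aC] := C1_closed_bounds l0 Ca a0 al.
have [[da _ _] _] := Ca.
have cf : {in `]0, l[, continuous (fun x : R => (2 * x - l) / a x)}.
  move=> x xl; apply: cvgM.
    by apply: cvgB; [apply: cvgMr; exact: cvg_id|exact: cvg_cst].
  apply: cvgV; first by rewrite gt_eqF// a_gt0.
  by apply/differentiable_continuous/derivable1_diffP/da.
have [h dh] := primitive_oo l0 cf.
exists h.
have hl := @log_lower_bound _ l C a h l0 C0.
(* The reflection [x -> l - x] preserves the differential equation of [h], so the right end reduces
   to the left one. *)
have hr := @log_lower_bound _ l C (fun x => a (l - x)) (fun x => h (l - x))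
  l0 C0.
have refl x : x \in `]0, l[ -> l - x \in `]0, l[.
  by rewrite !in_itv/= subr_gt0 ltrBlDr ltrDl andbC.
have {}hl x : 0 < x <= l / 2 ->
    h (l / 2) + l / C * (ln (l / 2) - ln x) - l / C <= h x.
  by apply: hl => // y yl; rewrite a_gt0//=; have [] := aC _ yl.
have {}hr x : 0 < x <= l / 2 ->
    h (l / 2) + l / C * (ln (l / 2) - ln x) - l / C <= h (l - x).
  move=> xl; have {1}-> : l / 2 = l - l / 2 by field.
  apply: hr xl => y yl.
    rewrite a_gt0 ?refl//=; have [_ + _] := aC _ (refl _ yl).
    by rewrite subKr.
  have dg : is_derive y 1 (fun z : R => l - z) (- 1).
    have dly := is_deriveB (is_derive_cst l y 1) (is_derive_id y 1).
    exact: is_derive_eq dly (sub0r 1).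
  have dhg := @is_derive1_comp _ h (fun z => l - z) y _ _ (dh _ (refl _ yl)) dg.
  apply: is_derive_eq dhg _.
  by rewrite /= mulrN1 -mulNr; congr (_ / _); ring.
have lC : 0 < l / C by rewrite divr_gt0.
have l2 : 0 < l / 2 by rewrite divr_gt0.
have bound x : 0 < x <= l / 2 -> l / C * (ln (l / 2) - ln x) >= 0.
  move=> /andP[x0 xl]; apply: mulr_ge0; first exact: ltW.
  by rewrite subr_ge0 ler_ln ?posrE.
split=> //.
- exists (h (l / 2) - l / C) => x; rewrite in_itv/= => /andP[x0 xl].
  have [xm|xm] := leP x (l / 2).
    have xE : 0 < x <= l / 2 by rewrite x0.
    by have := hl _ xE; have := bound _ xE; lra.
  have xE : 0 < l - x <= l / 2 by apply/andP; split; lra.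
  have := hr _ xE; have := bound _ xE; rewrite subKr; lra.
(* [K] is the logarithmic gain that lifts the lower bound to [M], and [l / 2 * expR (- K)] is the
   point where the gain is [K]; [1 <= K] keeps this point below [l / 2]. *)
- move=> M; pose K := Num.max 1 ((M - h (l / 2) + l / C) / (l / C)).
  have K1 : 1 <= K by rewrite le_max lexx.
  have KM : M <= h (l / 2) + l / C * K - l / C.
    have : (M - h (l / 2) + l / C) / (l / C) <= K by rewrite le_max lexx orbT.
    by rewrite ler_pdivrMr// mulrC; lra.
  exists (l / 2 * expR (- K)).
    rewrite mulr_gt0 ?expR_gt0//= gtr_pMr// -expR0 ltr_expR; lra.
  have big x : 0 < x -> x <= l / 2 * expR (- K) ->
      K <= ln (l / 2) - ln x.
    move=> x0 xe; have : ln x <= ln (l / 2 * expR (- K)).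
      by rewrite ler_ln ?posrE ?mulr_gt0 ?expR_gt0.
    by rewrite lnM ?posrE ?expR_gt0// expRK; lra.
  have e2 : l / 2 * expR (- K) <= l / 2.
    rewrite ger_pMr// -expR0 ler_expR; lra.
  move=> x; rewrite in_itv/= => /andP[x0 xl].
  have [xe|xe] := leP x (l / 2 * expR (- K)).
    left; apply: le_trans KM _.
    have xE : 0 < x <= l / 2 by rewrite x0/= (le_trans xe).
    apply: le_trans (hl _ xE); rewrite lerB// lerD2l ler_pM2l//.
    exact: big.
  have [lxe|lxe] := leP (l - x) (l / 2 * expR (- K)).
    left; apply: le_trans KM _.
    have xE : 0 < l - x <= l / 2 by rewrite subr_gt0 xl/= (le_trans lxe).
    have := hr _ xE; rewrite subKr; apply: le_trans.
    by rewrite lerB// lerD2l ler_pM2l// big// subr_gt0.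
  right; lra.
Qed.

Lemma within_continuous_minorant {T : topologicalType} {R : realType}
    (D : set T) (w : T -> R) : compact D -> {within D, continuous w} ->
  exists2 M, 0 <= M & forall z, D z -> - M <= w z.
Proof.
move=> cD cw; have [->|D0] := eqVneq D set0; first by exists 0.
move/set0P in D0.
have [c _ wc] := compact_EVT_min D0 cD cw.
exists `|w c| => // z Dz.
by have := wc z (mem_set Dz); have := ler_norm (- w c); rewrite normrN; lra.
Qed.

Lemma compact_Qbar {R : realType} (l T : R) : compact (Qbar l T).
Proof. by apply: compact_setX; exact: segment_compact. Qed.

(** The slope 3 in time outweighs [(a h')' = 2] and leaves 1. The constant [A] is free, to be chosen
    so that the barrier is positive and the term with [q] has a sign. *)
Lemma residual_at_singular_barrier {R : realType} (l T A : R)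
    (a q h : R -> R) :
  {in `]0, l[, forall x, 0 < a x} ->
  {in `]0, l[, forall x : R, is_derive x 1 h ((2 * x - l) / a x)} ->
  forall x t, x \in `]0, l[ ->
    residual_at T a q (fun y s => h y + (A + 3 * s)) x t
      (1 + q x * (h x + (A + 3 * t))).
Proof.
move=> a0 dh x t xl.
have nl : \forall y \near x, y \in `]0, l[ by apply: near_in_itvoo.
have -> : 1 + q x * (h x + (A + 3 * t)) = 3 - 2 + q x * (h x + (A + 3 * t)).
  by ring.
have dx : \forall y \near x, is_derive (y : R) 1
    (fun y => h y + (A + 3 * t)) ((2 * y - l) / a y).
  apply: filterS nl => y yl.
  have dhA := is_deriveD (dh y yl) (is_derive_cst (A + 3 * t) y 1).
  exact: is_derive_eq dhA (addr0 _).
have dF : is_derive x 1 (fun y => a y * ((2 * y - l) / a y)) 2.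
  have nF : \forall y \near x, 2 *: y - l = a y * ((2 * y - l) / a y).
    by apply: filterS nl => y yl; rewrite mulrC divfK// gt_eqF// a0.
  apply: near_eq_is_derive nF _.
  have d2 := is_deriveZ 2 (is_derive_id x 1).
  apply: is_derive_eq (is_deriveB d2 (is_derive_cst l x 1)) _.
  by rewrite subr0 [LHS]mulr1.
have dt : is_derive t 1 (fun s => h x + (A + 3 * s)) 3.
  have dA := is_deriveD (is_derive_cst A t 1) (is_deriveZ 3 (is_derive_id t 1)).
  apply: is_derive_eq (is_deriveD (is_derive_cst (h x) t 1) dA) _.
  by rewrite !add0r [LHS]mulr1.
exact: (@residual_at_is_derive R T a q
  (fun y s => h y + (A + 3 * s)) _ x t 2 3 dx dF dt).
Qed.

(** * The travelling bump *)

(** For [r > 0], positive exactly at distance less than [r] from the moving point [c + k * t]. It is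
    not cut off outside: comparison takes place only where it is nonnegative, and a polynomial has
    explicit derivatives. *)
Definition tube {R : realType} (r c k x t : R) : R :=
  r ^+ 2 - (x - (c + k * t)) ^+ 2.

Lemma is_derive_sqr {R : realType} (f : R -> R) (x f' : R) :
  is_derive x 1 f f' -> is_derive x 1 (fun y => f y ^+ 2) (2 * f x * f').
Proof.
move=> df; apply: is_derive_eq (is_deriveM df df) _.
by rewrite /GRing.scale/=; move: (f x) => y; ring.
Qed.

Lemma is_derive_sqr_tube {R : realType} (f : R -> R) (r x f' : R) :
  is_derive x 1 f f' ->
  is_derive x 1 (fun y => (r ^+ 2 - f y ^+ 2) ^+ 2)
    (- 4 * (r ^+ 2 - f x ^+ 2) * f x * f').
Proof.
move=> df.
have ds := is_deriveB (is_derive_cst (r ^+ 2) x 1) (is_derive_sqr df).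
apply: is_derive_eq (is_derive_sqr ds) _.
rewrite !fctE sub0r.
by move: (f x) => y; ring.
Qed.

(** The terms are grouped by powers of [s]. The one without [s], [- 8 * a x * y ^+ 2], gives
    negativity near the edge of the tube, where [s] is small; further inside, a large [K] does. *)
Lemma residual_at_tube {R : realType} (T K r c k : R) (a q : R -> R) (x t : R) :
  (\forall y \near x, derivable a y 1) ->
  let y := x - (c + k * t) in let s := tube r c k x t in
  residual_at T a q (fun x t => expR (- K * t) * tube r c k x t ^+ 2) x t
    (expR (- K * t) * (s * (4 * y * k + 4 * derive1 a x * y + 4 * a x)
       - 8 * a x * y ^+ 2 + (q x - K) * s ^+ 2)).
Proof.
move=> da y s; set e := expR (- K * t).
have dy (z : R) : is_derive z 1 (fun x => x - (c + k * t)) 1.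
  have dz := is_deriveB (is_derive_id z 1) (is_derive_cst (c + k * t) z 1).
  exact: is_derive_eq dz (subr0 _).
have dx : \forall z \near x, is_derive (z : R) 1
    (fun x => e * tube r c k x t ^+ 2)
    (e * (- 4 * tube r c k z t * (z - (c + k * t)))).
  near=> z.
  apply: is_derive_eq (is_deriveZ e (is_derive_sqr_tube r (dy z))) _.
  by rewrite mulr1.
have dax : is_derive x 1 a (derive1 a x).
  by rewrite derive1E; apply/derivableP; exact: nbhs_singleton da.
have dF : is_derive x 1
    (fun z => a z * (e * (- 4 * tube r c k z t * (z - (c + k * t)))))
    (e * (- 4 * s * y * derive1 a x + a x * (8 * y ^+ 2 - 4 * s))).
  have dyy : is_derive x 1 (fun z => (z - (c + k * t)) ^+ 2) (2 * y).
    exact: is_derive_eq (is_derive_sqr (dy x)) (mulr1 _).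
  have ds := is_deriveB (is_derive_cst (r ^+ 2) x 1) dyy.
  have dsy := is_deriveM (is_deriveZ (- 4) ds) (dy x).
  apply: is_derive_eq (is_deriveM dax (is_deriveZ e dsy)) _.
  rewrite [LHS](_ : _ = a x * (e * (- 4 * s * 1 + y * (- 4 * (0 - 2 * y)))) +
                        e * (- 4 * s * y) * derive1 a x)//.
  by move: (derive1 a x) (a x) => a' ax; ring.
have dt : is_derive t 1 (fun t => expR (- K * t) * tube r c k x t ^+ 2)
    (e * (- K * s ^+ 2 + 4 * s * y * k)).
  have dk : is_derive t 1 (fun z => x - (c + k * z)) (- k).
    apply: is_derive_eq (is_deriveB (is_derive_cst x t 1)
      (is_deriveD (is_derive_cst c t 1) (is_deriveZ k (is_derive_id t 1)))) _.
    by rewrite !add0r [_ *: _]mulr1.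
  have dKt : is_derive t 1 (fun z => - K * z) (- K).
    exact: is_derive_eq (is_deriveZ (- K) (is_derive_id t 1)) (mulr1 _).
  have de := is_derive1_comp (is_derive_expR (- K * t)) dKt.
  apply: is_derive_eq (is_deriveM de (is_derive_sqr_tube r dk)) _.
  rewrite /GRing.scale/= -/e -/y -[r ^+ 2 - y ^+ 2]/s.
  by ring.
have -> : e * (s * (4 * y * k + 4 * derive1 a x * y + 4 * a x)
       - 8 * a x * y ^+ 2 + (q x - K) * s ^+ 2) =
   e * (- K * s ^+ 2 + 4 * s * y * k) -
   e * (- 4 * s * y * derive1 a x + a x * (8 * y ^+ 2 - 4 * s)) +
   q x * (e * s ^+ 2).
  by move: (derive1 a x) (a x) (q x) => a' ax qx; ring.
exact: (@residual_at_is_derive R T a q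
  (fun x t => expR (- K * t) * tube r c k x t ^+ 2) _ x t _ _ dx dF dt).
Unshelve. all: by end_near. Qed.

(** * Minimum principle and strict positivity for the degenerate equation *)

Section degenerate_parabolic.
Context {R : realType} {l T : R} {a q : R -> R} {w : R -> R -> R}.
Hypotheses (l0 : 0 < l) (T0 : 0 < T).
Hypotheses (Ca : C1_closed l a) (a0 : a 0 = 0) (al : a l = 0).
Hypothesis a_gt0 : {in `]0, l[, forall x, 0 < a x}.
Hypothesis q_ge0 : {in `]0, l[, forall x, 0 <= q x}.
Hypothesis cw : {within Qbar l T, continuous (fun z : R * R => w z.1 z.2)}.
Hypothesis supersol : forall x t, x \in `]0, l[ -> t \in `]0, T] ->
  exists2 r, 0 <= r & residual_at T a q w x t r.

(** For [eps > 0] the function [w + eps * b] has residual at least [eps], and it can be negative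
    only on some [[e, l - e]], since [w] is bounded below and [b] blows up at the ends. There
    [min_principle] applies. *)
Lemma weak_minimum_principle : {in `]0, l[, forall x, 0 <= w x 0} ->
  forall x t, x \in `]0, l[ -> t \in `[0, T] -> 0 <= w x t.
Proof.
move=> w0.
have [h [dh [B hB] blowup]] := singular_barrier l0 Ca a0 al a_gt0.
have [M M0 wM] := within_continuous_minorant (@compact_Qbar R l T) cw.
(* The shift [1 - B] makes [b >= 1] for nonnegative times. *)
pose b x t := h x + (1 - B + 3 * t).
have b1 x t : x \in `]0, l[ -> 0 <= t -> 1 <= b x t.
  by move=> xl t0; have := hB x xl; rewrite /b; lra.
have zpos eps x t : 0 < eps -> x \in `]0, l[ -> t \in `[0, T] ->
    0 <= w x t + eps * b x t.
  move=> eps0 xl tT.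
  (* Above this level of [h] one has [eps * b >= M], which compensates [w >= - M]. *)
  have [e /andP[e0 el] far] := blowup (M / eps + B).
  have farb y s : y \in `]0, l[ -> s \in `[0, T] -> w y s + eps * b y s < 0 ->
      e < y < l - e.
    move=> yl sT; have [hy|//] := far y yl.
    have wys : - M <= w y s.
      by apply: (wM (y, s)); split=> //=; exact: subset_itv_oo_cc yl.
    have s_ge0 : 0 <= s by move: sT; rewrite in_itv/= => /andP[].
    have : eps * (M / eps) <= eps * b y s.
      by apply: ler_wpM2l; [exact: ltW|rewrite /b; lra].
    have -> : eps * (M / eps) = M by field; rewrite gt_eqF.
    move: (eps * b y s) => b'; lra.
  rewrite leNgt; apply/negP => zneg.
  have /andP[ex xe] := farb _ _ xl tT zneg.
  pose D : set (R * R) := [set` `[e, l - e]] `*` [set` `[0, T]].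
  have Dl y s : D (y, s) -> (y \in `]0, l[) /\ (s \in `[0, T]).
    by move=> [/=]; rewrite !in_itv/= => /andP[ey ye] ->; split => //; lra.
  suff : 0 <= w x t + eps * b x t by rewrite leNgt zneg.
  apply: (@min_principle _ T a q (fun x t => w x t + eps * b x t) D).
  - by apply: compact_setX; exact: segment_compact.
  - apply: within_continuousD.
      apply: continuous_subspaceW cw => -[y s] /Dl[/= yl sT].
      by split => //=; exact: subset_itv_oo_cc yl.
    apply: continuous_in_subspaceT => -[y s] /set_mem/Dl[yl sT].
    have ch : {for y, continuous h}.
      apply/differentiable_continuous/derivable1_diffP.
      by have [] := dh y yl.
    apply: cvgMr; apply: cvgD.
      by apply: (@cvg_comp _ _ _ fst h _ (nbhs y)); [exact: cvg_fst|exact: ch].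
    apply: cvgD; first exact: cvg_cst.
    by apply: cvgMr; exact: cvg_snd.
  - move=> y s Dys zlt0; have [yl sT] := Dl _ _ Dys.
    have /andP[ey ye] := farb _ _ yl sT zlt0.
    move: (sT); rewrite in_itv/= => /andP[s_ge0 sleT].
    have s0 : 0 < s.
      rewrite lt_neqAle s_ge0 andbT; apply/eqP => s0.
      move: zlt0; apply/negP; rewrite -leNgt -s0 addr_ge0 ?w0//.
      by rewrite mulr_ge0 ?ltW// (lt_le_trans ltr01)// b1.
    split => //; first exact: q_ge0.
    + have : \forall y' \near y, y' \in `]e, l - e[.
        by apply: near_in_itvoo; rewrite in_itv/= ey.
      apply: filterS => y' y'e; split.
        by split=> //=; exact: subset_itv_oo_cc y'e.
      apply/ltW/a_gt0; move: y'e; rewrite !in_itv/=; lra.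
    + near=> d; split => /=; first by rewrite in_itv/= !ltW.
      have dlt0 : d < 0 by near: d; exact: nbhs_left_lt.
      have ds : - s < d by near: d; apply: nbhs_left_gt; rewrite oppr_lt0.
      by rewrite in_itv/=; lra.
    + have s0T : s \in `]0, T] by rewrite in_itv/= s0.
      have [r r0 res] := @supersol y s yl s0T.
      exists (r + eps * (1 + q y * b y s)).
        rewrite ltr_wpDl// mulr_gt0// ltr_wpDr//.
        by rewrite mulr_ge0 ?q_ge0// (le_trans ler01)// b1.
      apply: residual_at_lincomb res _.
      exact: (@residual_at_singular_barrier R l T (1 - B) a q h a_gt0 dh
        y s yl).
  - by split => /=; rewrite // in_itv/= !ltW.
move=> x t xl tT; rewrite leNgt; apply/negP => wneg.
have bxt : 1 <= b x t by apply: b1 => //; move: tT; rewrite in_itv/= => /andP[].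
have b0 : 0 < b x t by apply: lt_le_trans bxt.
(* In place of a limit [eps -> 0]: this value turns [w + eps * b] into [w / 2], still negative. *)
have eps0 : 0 < - w x t / (2 * b x t) by rewrite divr_gt0 ?oppr_gt0 ?mulr_gt0.
have := zpos _ x t eps0 xl tT.
have -> : w x t + - w x t / (2 * b x t) * b x t = w x t / 2.
  by field; rewrite gt_eqF.
by apply/negP; rewrite -ltNge ltr_pdivrMr// mul0r.
Unshelve. all: by end_near. Qed.

(** The centre of the bump moves at constant speed from [x0] at time 0 to [x1] at time [T]. With a
    fast enough exponential decay the bump is a strict subsolution inside its tube, so a small
    multiple of it stays below [w] up to time [T]. *)
Lemma strict_positivity (x0 x1 m : R) : {in `]0, l[, continuous q} ->
  (forall x t, x \in `]0, l[ -> t \in `[0, T] -> 0 <= w x t) ->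
  x0 \in `]0, l[ -> x1 \in `]0, l[ -> 0 < m ->
  (\forall y \near x0, m <= w y 0) -> 0 < w x1 T.
Proof.
move=> cq w_ge0 x0l x1l m0 /near_itvoo[e e0 wm].
have Tge0 := ltW T0.
have [C C0 aC] := C1_closed_bounds l0 Ca a0 al.
have [[da _ _] _] := Ca.
move: x0l x1l; rewrite !in_itv/= => /andP[x0_gt0 x0_ltl] /andP[x1_gt0 x1_ltl].
pose lo := Num.min x0 x1; pose hi := Num.max x0 x1.
have lo0 : 0 < lo by rewrite lt_min x0_gt0.
have hil : hi < l by rewrite gt_max x0_ltl.
have [lox0 lox1] : lo <= x0 /\ lo <= x1 by rewrite !ge_min !lexx orbT.
have [x0hi x1hi] : x0 <= hi /\ x1 <= hi by rewrite !le_max !lexx orbT.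
(* [r < e] puts the base of the tube where [m <= w]; the other two bounds keep the whole tube in the
   compact part [[al', be]] of the open interval, where [a] has a positive minimum and [q] a
   maximum. *)
pose r := Num.min e (Num.min lo (l - hi)) / 2.
have d0 : 0 < Num.min e (Num.min lo (l - hi)).
  by rewrite lt_min e0 lt_min lo0 subr_gt0.
have r0 : 0 < r by rewrite divr_gt0.
have rge0 := ltW r0.
have rd : r < Num.min e (Num.min lo (l - hi)).
  by rewrite ltr_pdivrMr// ltr_pMr// ltr1n.
have [re rlo rhi] : [/\ r < e, r < lo & r < l - hi].
  by move: rd; rewrite lt_min => /andP[->]; rewrite lt_min => /andP[-> ->].
pose al' := lo - r; pose be := hi + r.
have subl x : x \in `[al', be] -> x \in `]0, l[.
  by rewrite !in_itv/= /al' /be; lra.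
have albe : al' <= be by rewrite /al' /be; lra.
have [xm xml xmin] : exists2 c, c \in `[al', be] &
    forall x, x \in `[al', be] -> a c <= a x.
  apply: EVT_min => //; apply: derivable_within_continuous => x xab.
  exact/da/subl.
have [xM xMl xMax] : exists2 c, c \in `[al', be] &
    forall x, x \in `[al', be] -> q x <= q c.
  apply: EVT_max => //; apply: continuous_in_subspaceT => x /set_mem xab.
  exact/cq/subl.
have am0 : 0 < a xm by exact/a_gt0/subl.
pose k := (x1 - x0) / T.
(* With [y ^+ 2 = r ^+ 2 - s], the term [- 8 a y ^+ 2] splits into [- 8 a r ^+ 2], at most [- E],
   and [8 a s], which joins [4 a s] to give the 12. [B] bounds the resulting coefficient of [s], by
   [|y| <= r], [|a'| <= C] and [a <= C * l]. *)
pose B := 4 * r * `|k| + 4 * C * r + 12 * (C * l).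
pose E := 8 * a xm * r ^+ 2.
have E0 : 0 < E by rewrite !mulr_gt0 ?exprn_gt0.
(* With this [K] the residual of the bump is, up to a positive factor, at most
   [- (E - B s + (B ^+ 2 / E) s ^+ 2)], which has no real zero in [s]. *)
pose K := q xM + B ^+ 2 / E.
pose s x t := tube r x0 k x t.
pose v x t := expR (- K * t) * s x t ^+ 2.
have path t : t \in `[0, T] -> lo <= x0 + k * t <= hi.
  rewrite in_itv/= => /andP[t0 tT].
  have -> : x0 + k * t = x0 * (1 - t / T) + x1 * (t / T).
    by rewrite /k; field; rewrite gt_eqF.
  have : 0 <= t / T <= 1 by rewrite divr_ge0//= ler_pdivrMr// mul1r.
  move: (t / T) => tau; nra.
have intube x t : t \in `[0, T] -> 0 <= s x t ->
    [/\ x \in `[al', be], `|x - (x0 + k * t)| <= r & x \in `]0, l[].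
  move=> tT; rewrite /s /tube subr_ge0 -ler_sqrt ?exprn_ge0// => sx.
  have xr : `|x - (x0 + k * t)| <= r.
    by move: sx; rewrite !sqrtr_sqr (gtr0_norm r0).
  have xab : x \in `[al', be].
    move: xr (path t tT); rewrite ler_distl in_itv/= /al' /be; lra.
  by split => //; exact: subl.
have resv x t : t \in `[0, T] -> 0 < s x t ->
    exists2 rv, rv < 0 & residual_at T a q v x t rv.
  move=> tT s0; have [xab xr xl] := intube _ _ tT (ltW s0).
  have nda : \forall y \near x, derivable a y 1.
    have : \forall y \near x, y \in `]0, l[ by exact: near_in_itvoo.
    by apply: filterS => y; exact: da.
  eexists; last exact: (residual_at_tube T K r x0 k q t nda).
  rewrite pmulr_rlt0 ?expR_gt0// -/(s x t).
  have -> : (x - (x0 + k * t)) ^+ 2 = r ^+ 2 - s x t by rewrite subKr.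
  have aBound := xmin _ xab; have qBound := xMax _ xab.
  have [axC _ a'C] := aC _ xl.
  have axl : a x <= C * l.
    move: xl; rewrite in_itv/= => /andP[_ /ltW xl].
    by rewrite (le_trans axC)// ler_wpM2l// ltW.
  move: xr a'C qBound aBound axl s0; rewrite /K /B.
  move: (x - (x0 + k * t)) (derive1 a x) (s x t) (q x) (a x) => y a' sx qx ax.
  move=> xr a'C qBound aBound axl s0.
  have yk : y * k <= r * `|k|.
    by rewrite (le_trans (ler_norm _))// normrM ler_wpM2r.
  have a'y : a' * y <= C * r.
    by rewrite (le_trans (ler_norm _))// normrM ler_pM.
  have : sx * (4 * y * k + 4 * a' * y + 12 * ax) <= sx * B.
    by rewrite ler_pM2l// /B; lra.
  have : 8 * a xm * r ^+ 2 <= 8 * ax * r ^+ 2.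
    by rewrite ler_wpM2r ?exprn_ge0// ler_wpM2l.
  have : (qx - q xM) * sx ^+ 2 <= 0.
    by rewrite mulr_le0_ge0 ?sqr_ge0// subr_le0.
  have quad : 0 < E - B * sx + B ^+ 2 / E * sx ^+ 2.
    have -> : E - B * sx + B ^+ 2 / E * sx ^+ 2 =
        E * ((B * sx / E - 1 / 2) ^+ 2 + 3 / 4).
      by field; rewrite gt_eqF.
    by rewrite mulr_gt0// ltr_wpDl ?sqr_ge0.
  move: quad; rewrite -/B -/E; move: (B ^+ 2 / E) => BE.
  lra.
have s_cont : continuous (fun z : R * R => s z.1 z.2).
  move=> z; apply: cvgB; first exact: cvg_cst.
  have cy : (fun z : R * R => z.1 - (x0 + k * z.2)) @ z -->
      z.1 - (x0 + k * z.2).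
    apply: cvgB; first exact: cvg_fst.
    by apply: cvgD; [exact: cvg_cst|apply: cvgMr; exact: cvg_snd].
  exact: cvgM.
have v_cont : continuous (fun z : R * R => v z.1 z.2).
  move=> z; apply: cvgM.
    apply: continuous_comp; last exact: continuous_expR.
    by apply: cvgMr; exact: cvg_snd.
  by apply: cvgM; exact: s_cont.
(* At time 0 the bump is [s ^+ 2 <= r ^+ 4], so [eps * v <= m <= w] there. *)
pose eps := m / r ^+ 4.
have eps0 : 0 < eps by rewrite divr_gt0// exprn_gt0.
(* On the lateral boundary of this closed tube [s = 0], so the difference is [w >= 0]. Hence it can
   be negative only where [s > 0] and [t > 0]. *)
pose D : set (R * R) := Qbar l T `&` [set z | 0 <= s z.1 z.2].
have near_s x t : 0 < s x t ->
    (\forall y \near x, 0 < s y t) /\ (\forall u \near t, 0 < s x u).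
  move=> s0; split.
    have cy : (fun y => y - (x0 + k * t)) @ x --> x - (x0 + k * t).
      by apply: cvgB; [exact: cvg_id|exact: cvg_cst].
    have : s y t @[y --> x] --> s x t.
      by apply: cvgB; [exact: cvg_cst|exact: cvgM].
    by move/cvgr_gt; apply.
  have cu : (fun u => x - (x0 + k * u)) @ t --> x - (x0 + k * t).
    apply: cvgB; first exact: cvg_cst.
    by apply: cvgD; [exact: cvg_cst|apply: cvgMr; exact: cvg_id].
  have : s x u @[u --> t] --> s x t.
    by apply: cvgB; [exact: cvg_cst|exact: cvgM].
  by move/cvgr_gt; apply.
have D_ge0 : forall x t, D (x, t) -> 0 <= w x t + - eps * v x t.
  apply: (@min_principle _ T a q (fun x t => w x t + - eps * v x t) D).
  - apply: compact_closedI; first exact: compact_Qbar.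
    have /continuous_closedP/(_ _ (@closed_ge R 0)) := s_cont.
    exact.
  - apply: within_continuousD.
      by apply: continuous_subspaceW cw => z [].
    apply: continuous_subspaceT => z; apply: cvgMr; exact: v_cont.
  - move=> x t [[/= xl tT] sge0] zlt0.
    have [_ xr xloo] := intube _ _ tT sge0.
    have s0 : 0 < s x t.
      rewrite lt_neqAle sge0 andbT; apply/eqP => s0.
      move: zlt0; apply/negP; rewrite -leNgt /v -s0 expr0n/= !mulr0 addr0.
      exact: w_ge0.
    move: (tT); rewrite in_itv/= => /andP[t_ge0 tleT].
    have t0 : 0 < t.
      rewrite lt_neqAle t_ge0 andbT; apply/eqP => t0.
      move: zlt0; apply/negP; rewrite -leNgt /v -t0 !mulr0 expR0 mul1r.
      rewrite mulNr subr_ge0 -t0 mulr0 addr0 in xr *.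
      apply: (@le_trans _ _ m); last first.
        apply: wm; move: xr; rewrite ler_distl in_itv/=; lra.
      rewrite /eps -mulrA ger_pMr// mulrC ler_pdivrMr ?exprn_gt0// mul1r.
      rewrite (exprM r 2 2) lerXn2r ?nnegrE ?sqr_ge0//.
        by move: sge0; rewrite -t0.
      by rewrite /s /tube gerBl sqr_ge0.
    have [ns ns'] := near_s _ _ s0.
    split => //; first exact: q_ge0.
    + have nx : \forall y \near x, y \in `]0, l[ by exact: near_in_itvoo.
      apply: filterS2 nx ns => y yl sy; split; last exact/ltW/a_gt0.
      split; last exact: ltW.
      by split => //=; exact: subset_itv_oo_cc yl.
    + have ns0 : \forall h \near 0^'-, 0 < s x (t + h).
        have th : (t + h) @[h --> 0^'-] --> t.
          rewrite -[X in _ --> X]addr0; apply: cvgD; first exact: cvg_cst.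
          exact: cvg_at_left_filter cvg_id.
        exact: th ns'.
      near=> h; split; last by apply: ltW; near: h.
      have hlt0 : h < 0 by near: h; exact: nbhs_left_lt.
      have ht : - t < h by near: h; apply: nbhs_left_gt; rewrite oppr_lt0.
      by split => //=; rewrite in_itv/=; lra.
    + have t0T : t \in `]0, T] by rewrite in_itv/= t0.
      have [rw rw0 resw] := @supersol x t xloo t0T.
      have [rv rv0 resv'] := resv _ _ tT s0.
      exists (rw + - eps * rv).
        by rewrite ltr_wpDl// nmulr_lgt0// oppr_lt0.
      exact: residual_at_lincomb resw resv'.
have TT : T \in `[0, T] by rewrite in_itv/= lexx ltW.
have sT : s x1 T = r ^+ 2.
  by rewrite /s /tube /k; field; rewrite gt_eqF.
have : 0 <= w x1 T + - eps * v x1 T.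
  apply: D_ge0; split; last by rewrite /= sT sqr_ge0.
  by split => //=; rewrite in_itv/= !ltW.
rewrite mulNr subr_ge0; apply: lt_le_trans.
by rewrite mulr_gt0// mulr_gt0 ?expR_gt0// sT !exprn_gt0.
Unshelve. all: by end_near. Qed.

End degenerate_parabolic.

(** * Solutions of the inverse problem *)

Lemma solves_equation_residual {R : realType} (l T : R) (a q : R -> R)
    (u : R -> R -> R) : solves_equation l T a q u ->
  forall x t, x \in `]0, l[ -> t \in `]0, T] -> residual_at T a q u x t 0.
Proof.
move=> ueq x t xl tT; have [_ dF ed] := ueq x t xl tT.
split; [|exact: dF|exact: ed].
have nl : \forall y \near x, y \in `]0, l[ by exact: near_in_itvoo.
by apply: filterS nl => y yl; have [dy _ _] := ueq y t yl tT.
Qed.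

(** Allows the solution for one coefficient to be inserted in the operator of another, so that two
    solutions can be subtracted. *)
Lemma residual_at_coef {R : realType} (T : R) (a q q' : R -> R)
    (w : R -> R -> R) (x t r : R) : residual_at T a q w x t r ->
  residual_at T a q' w x t (r + (q' x - q x) * w x t).
Proof.
move=> [nw dF [d wd <-]]; split; [exact: nw|exact: dF|exists d => //].
by rewrite mulrBl addrA addrAC addrK.
Qed.

Lemma within_Qbar_slice {R : realType} (l T t : R) (u : R -> R -> R) :
  t \in `[0, T] ->
  {within Qbar l T, continuous (fun z : R * R => u z.1 z.2)} ->
  {within `[0, l], continuous (u ^~ t)}.
Proof.
move=> tT /subspace_continuousP cu; apply/subspace_continuousP => x xl.
have xtQ : Qbar l T (x, t) by split.
apply: cvg_trans (cu _ xtQ) => A /= [[B C] [/= nB nC] BCA].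
apply: filterS nB => y By yl; apply: (BCA (y, t)); last by split.
by split => //; exact: nbhs_singleton nC.
Qed.

(** The equation holds only in the open interval; the ends are reached by one-sided limits. *)
Lemma eq_segment_oo {R : realType} (l : R) (f g : R -> R) : 0 < l ->
  {within `[0, l], continuous f} -> {within `[0, l], continuous g} ->
  {in `]0, l[, f =1 g} -> {in `[0, l], f =1 g}.
Proof.
move=> l0 /(continuous_within_itvP _ l0)[_ f0 fl].
move=> /(continuous_within_itvP _ l0)[_ g0 gl] fg x.
rewrite in_itv/= => /andP[]; rewrite le_eqVlt => /predU1P[<- _|x0].
  have fg0 : \forall y \near 0^'+, g y = f y.
    near=> y; apply/esym/fg; rewrite in_itv/=; apply/andP; split; near: y.
      exact: nbhs_right_gt.
    exact: nbhs_right_lt.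
  exact: cvg_unique f0 (cvg_trans (near_eq_cvg fg0) g0).
rewrite le_eqVlt => /predU1P[->|xl]; last by apply: fg; rewrite in_itv/= x0.
have fgl : \forall y \near l^'-, g y = f y.
  near=> y; apply/esym/fg; rewrite in_itv/=; apply/andP; split; near: y.
    exact: nbhs_left_gt.
  exact: nbhs_left_lt.
exact: cvg_unique fl (cvg_trans (near_eq_cvg fgl) gl).
Unshelve. all: by end_near. Qed.

Section inverse_problem.
Context {R : realType} {l T delta : R} {a phi g : R -> R}.
Hypotheses (l0 : 0 < l) (T0 : 0 < T) (delta0 : 0 < delta).
Hypothesis data : data_assumptions l delta a phi g.

Lemma Gset_segment x : x \in `[0, l] -> Gset l delta x.
Proof. by rewrite /Gset/= !in_itv/=; have := delta0; lra. Qed.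

Lemma solution_ge0 (q : R -> R) (u : R -> R -> R) :
  solves_inverse l T delta a phi g q u ->
  forall x t, x \in `]0, l[ -> t \in `[0, T] -> 0 <= u x t.
Proof.
move=> [[_ q0] [[cu _] ueq u0] _].
have [[Ca a0 al a_gt0] _ [_ phi0 _] _] := data.
apply: (@weak_minimum_principle R l T a q) => //.
- by move=> x xl; apply/q0/Gset_segment/subset_itv_oo_cc.
- move=> x t xl tT; exists 0 => //.
  exact: solves_equation_residual ueq _ _ xl tT.
- by move=> x xl; rewrite u0// phi0.
Qed.

(** By continuity of [phi], the initial value stays above [phi x0 / 2] near a point [x0] with
    [phi x0 > 0], from where positivity spreads. The result serves to divide by [u1 x T] when
    coefficients are compared. *)
Lemma solution_final_gt0 (q : R -> R) (u : R -> R -> R) :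
  solves_inverse l T delta a phi g q u ->
  forall x, x \in `]0, l[ -> 0 < u x T.
Proof.
move=> sol x xl; have u_ge0 := solution_ge0 sol.
move: sol => [[[cq _] q0] [[cu _] ueq u0] _].
have [[Ca a0 al a_gt0] _ [[cphi _] phi0 [x0 x0l phix0]] _] := data.
have Gx (y : R) : y \in `]0, l[ -> Gset l delta y.
  by move=> yl; apply/Gset_segment/subset_itv_oo_cc.
have phi_gt0 : 0 < phi x0 by rewrite lt_neqAle eq_sym phix0 phi0.
have nu : \forall y \near x0, phi x0 / 2 <= u y 0.
  have nl : \forall y \near x0, y \in `]0, l[ by exact: near_in_itvoo.
  have : \forall y \near x0, phi x0 / 2 < phi y.
    move/cvgr_gt: (cphi x0 (Gx x0 x0l)); apply.
    by rewrite ltr_pdivrMr// ltr_pMr// ltr1n.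
  by apply: filterS2 nl => y yl /ltW; rewrite u0.
apply: (@strict_positivity R l T a q u _ _ _ _ _ _ _ _ _ x0 x
  (phi x0 / 2)) => //.
- by move=> y yl; apply/q0/Gx.
- move=> y t yl tT; exists 0 => //.
  exact: solves_equation_residual ueq _ _ yl tT.
- by move=> y yl; apply/cq/Gx.
- by rewrite divr_gt0.
Qed.

Lemma coefficient_unique (q q1 : R -> R) (u u1 : R -> R -> R) :
  {in `]0, l[, forall x, q x <= q1 x} ->
  solves_inverse l T delta a phi g q u ->
  solves_inverse l T delta a phi g q1 u1 ->
  {in `]0, l[, q1 =1 q}.
Proof.
move=> qq1 sol sol1.
have u1_ge0 := solution_ge0 sol1; have u1_gt0 := solution_final_gt0 sol1.
move: sol sol1 => [[_ q0] [[cu _] ueq u0] uT] [_ [[cu1 _] u1eq u10] u1T].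
have [[Ca a0 al a_gt0] _ _ _] := data.
pose w x t := u x t + -1 * u1 x t.
have res x t : x \in `]0, l[ -> t \in `]0, T] ->
    residual_at T a q w x t ((q1 x - q x) * u1 x t).
  move=> xl tT.
  have -> : (q1 x - q x) * u1 x t =
      0 + -1 * (0 + (q x - q1 x) * u1 x t) by ring.
  apply: residual_at_lincomb.
    exact: solves_equation_residual ueq _ _ xl tT.
  apply: residual_at_coef; exact: solves_equation_residual u1eq _ _ xl tT.
have w_ge0 : forall x t, x \in `]0, l[ -> t \in `[0, T] -> 0 <= w x t.
  apply: (@weak_minimum_principle R l T a q) => //.
  - by move=> x xl; apply/q0/Gset_segment/subset_itv_oo_cc.
  - apply: within_continuousD; first exact: cu.
    by move=> z; apply: cvgMr; exact: cu1.
  - move=> x t xl tT; exists ((q1 x - q x) * u1 x t); last exact: res.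
    rewrite mulr_ge0 ?subr_ge0 ?qq1// u1_ge0//.
    exact: subset_itv_oc_cc tT.
  - by move=> x xl; rewrite /w u0// u10// mulN1r subrr.
have wT x : x \in `]0, l[ -> w x T = 0.
  move=> xl; have xl' := subset_itv_oo_cc xl.
  by rewrite /w uT// u1T// mulN1r subrr.
move=> x xl; apply/eqP; rewrite eq_le qq1// andbT -subr_le0.
rewrite -(pmulr_lle0 _ (u1_gt0 x xl)).
have TT : T \in `]0, T] by rewrite in_itv/= T0 lexx.
have [_ _ [d wd <-]] := res x T xl TT.
have nl : \forall y \near x, y \in `]0, l[ by exact: near_in_itvoo.
(* As [w] vanishes at time [T] in the whole open interval, so does its flux, and the residual
   reduces to the time derivative [d]. *)
have F0 : \forall y \near x, 0 = a y * partial_x w y T.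
  apply: filterS nl => y yl.
  have nyl : \forall z \near y, 0 = w z T.
    have : \forall z \near y, z \in `]0, l[ by exact: near_in_itvoo.
    by apply: filterS => z zl; rewrite wT.
  have [_] := near_eq_is_derive nyl (is_derive_cst (0 : R) y 1).
  by rewrite /partial_x derive1E => ->; rewrite mulr0.
have [_] := near_eq_is_derive F0 (is_derive_cst (0 : R) x 1).
rewrite -derive1E => ->; rewrite subr0 wT// mulr0 addr0.
(* [w] comes down to 0 at time [T] from nonnegative values, hence [d <= 0]. *)
apply: (time_derivative_past_min (lexx T) wd).
near=> h; rewrite wT//; apply: w_ge0 => //.
have h0 : h < 0 by near: h; exact: nbhs_left_lt.
have hT : - T < h by near: h; apply: nbhs_left_gt; rewrite oppr_lt0.
by rewrite in_itv/=; lra.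
Unshelve. all: by end_near. Qed.

(** With equal coefficients the difference has zero residual and zero initial value. One inequality
    suffices, as the two solutions can be exchanged. *)
Lemma solution_le (q q1 : R -> R) (u u1 : R -> R -> R) :
  {in `]0, l[, q1 =1 q} ->
  solves_inverse l T delta a phi g q u ->
  solves_inverse l T delta a phi g q1 u1 ->
  forall x t, x \in `]0, l[ -> t \in `[0, T] -> u1 x t <= u x t.
Proof.
move=> q1q [[_ q0] [[cu _] ueq u0] _] [_ [[cu1 _] u1eq u10] _].
have [[Ca a0 al a_gt0] _ _ _] := data.
move=> x t xl tT; rewrite -subr_ge0 -mulN1r.
apply: (@weak_minimum_principle R l T a q
  (fun x t => u x t + -1 * u1 x t)) => //.
- by move=> y yl; apply/q0/Gset_segment/subset_itv_oo_cc.
- apply: within_continuousD; first exact: cu.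
  by move=> z; apply: cvgMr; exact: cu1.
- move=> y s yl sT; exists (0 + -1 * (0 + (q y - q1 y) * u1 y s)).
    by rewrite q1q// subrr mul0r addr0 mulr0 addr0.
  apply: residual_at_lincomb.
    exact: solves_equation_residual ueq _ _ yl sT.
  apply: residual_at_coef; exact: solves_equation_residual u1eq _ _ yl sT.
- by move=> y yl; rewrite u0// u10// mulN1r subrr.
Qed.

End inverse_problem.

Unset Implicit Arguments.

Theorem theorem2p5 (R : realType) (l T delta : R) (a phi g : R -> R)
    (l_gt0 : 0 < l) (T_gt0 : 0 < T) (delta_gt0 : 0 < delta)
    (data : data_assumptions l delta a phi g)
    (q : R -> R) (u : R -> R -> R)
    (sol : solves_inverse l T delta a phi g q u)
    (q1 : R -> R) (u1 : R -> R -> R)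
    (q1_Sq : calS_at l delta q q1)
    (sol1 : solves_inverse l T delta a phi g q1 u1) :
  {in `[0, l], forall x, q1 x = q x} /\
  (forall x t : R, x \in `[0, l] -> t \in `[0, T] -> u1 x t = u x t).
Proof.
have oo x : x \in `]0, l[ -> Gset l delta x.
  by move=> xl; exact/(Gset_segment delta_gt0)/subset_itv_oo_cc.
have q1q : {in `]0, l[, q1 =1 q}.
  case: q1_Sq => _ [qq1|q1q] x xl.
    apply: (coefficient_unique l_gt0 T_gt0 delta_gt0 data _ sol sol1 xl).
    by move=> y /oo/qq1.
  apply/esym.
  apply: (coefficient_unique l_gt0 T_gt0 delta_gt0 data _ sol1 sol xl).
  by move=> y /oo/q1q.
have qq1 : {in `]0, l[, q =1 q1} by move=> x xl; rewrite q1q.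
split.
  (* Coefficients are continuous on a neighbourhood of the segment, so their equality extends to the
     ends. *)
  have cG f : Winf1 3 (Gset l delta) f -> {within `[0, l], continuous f}.
    move=> [cf _]; apply: continuous_in_subspaceT => x /set_mem xl.
    exact/cf/(Gset_segment delta_gt0).
  have [[Wq _] _ _] := sol; have [[Wq1 _] _ _] := sol1.
  exact: (eq_segment_oo l_gt0 (cG _ Wq1) (cG _ Wq) q1q).
move=> x t xl tT.
have [_ [[cu _] _ _] _] := sol; have [_ [[cu1 _] _ _] _] := sol1.
have ct1 := within_Qbar_slice tT cu1; have ct := within_Qbar_slice tT cu.
apply: (eq_segment_oo l_gt0 ct1 ct _ xl).
move=> y yl; apply/eqP; rewrite eq_le.
rewrite (solution_le l_gt0 delta_gt0 data q1q sol sol1)//=.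
exact: (solution_le l_gt0 delta_gt0 data qq1 sol1 sol).
Qed.
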